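(* Let $(A_\gamma)_{\gamma\in\Gamma}$ be a family of Banach algebras (over the same scalar field $\mathbb{R}$ or $\mathbb{C}$). Then the multiplications in $A_\gamma$ $(\gamma\in\Gamma)$ are equi-uniformly open if and only if $A=\big(\bigoplus_{\gamma\in\Gamma}A_\gamma\big)_{\ell_\infty(\Gamma)}$ has uniformly open multiplication. Moreover, in the latter case multiplication in $A$ is uniformly open with $\delta$ depending on $\varepsilon>0$ in the same way as in $A_\gamma$ $(\gamma\in\Gamma)$; that is, any function $\varepsilon\mapsto\delta(\varepsilon)$ witnessing equi-uniform openness of the multiplications in all $A_\gamma$ witnesses uniform openness of multiplication in $A$.
   Context: $\big(\bigoplus_{\gamma\in\Gamma}A_\gamma\big)_{\ell_\infty(\Gamma)}$ is the Banach algebra of all tuples $(x_\gamma)_{\gamma\in\Gamma}$ with $x_\gamma\in A_\gamma$ and $\sup_\gamma\|x_\gamma\|<\infty$, with the supremum norm and coordinate-wise multiplication. $B(x,r)$ is the open ball and $U\cdot V=\{uv\colon u\in U,v\in V\}$. A function $\delta\colon(0,\infty)\to(0,\infty)$ witnesses uniform openness of multiplication in a Banach algebra $A$ if $B(xy,\delta(\varepsilon))\subseteq B(x,\varepsilon)\cdot B(y,\varepsilon)$ for all $x,y\in A$ and $\varepsilon>0$; multiplication in $A$ is uniformly open if such $\delta$ exists. The multiplications in $A_\gamma$ $(\gamma\in\Gamma)$ are equi-uniformly open if a single function $\delta$ witnesses uniform openness of multiplication in every $A_\gamma$. *)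

(* Defs.v *)
From HB Require Import structures.
From mathcomp Require Import all_boot all_order all_algebra complex.
From mathcomp Require Import all_classical all_reals all_analysis.

Set Implicit Arguments.
Unset Strict Implicit.
Unset Printing Implicit Defensive.

Import Order.TTheory GRing.Theory Num.Theory.
Import numFieldNormedType.Exports.

Local Open Scope classical_set_scope.
Local Open Scope ring_scope.

(* Over [R[i]] the norm takes its values in [R[i]] itself, whose order only
   compares numbers with the same imaginary part: [0 < e] forces [e] to be
   real, so that [{posnum R[i]}] is again the interval (0, oo). *)
Variant scalar_kind := RealScalars | ComplexScalars.

Definition scalars (R : realType) (k : scalar_kind) : numFieldType :=
  match k with
  | RealScalars => R
  | ComplexScalars => R[i]
  end.

(* Banach algebras need not be unital, hence not an instance of the (unital)
   ring structures of the algebraic hierarchy. *)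
HB.mixin Record CompleteNormedModule_isBanachAlgebra (K : numFieldType) V
    & CompleteNormedModule K V := {
  bmul : V -> V -> V;
  bmulA : associative bmul;
  bmulDl : left_distributive bmul +%R;
  bmulDr : right_distributive bmul +%R;
  bmulZl : forall (a : K) (x y : V), bmul (a *: x) y = a *: bmul x y;
  bmulZr : forall (a : K) (x y : V), bmul x (a *: y) = a *: bmul x y;
  ler_norm_bmul : forall x y : V, `|bmul x y| <= `|x| * `|y|
}.

#[short(type="banachAlgType")]
HB.structure Definition BanachAlgebra (K : numFieldType) :=
  {V of CompleteNormedModule K V & CompleteNormedModule_isBanachAlgebra K V}.

Section UniformOpenness.
Context {K : numFieldType}.

Definition witness_uniformly_open (delta : {posnum K} -> {posnum K})
    (A : banachAlgType K) : Prop :=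
  forall (x y : A) (e : {posnum K}),
    ball (bmul x y) (delta e)%:num `<=`
    [set bmul u v | u in ball x e%:num & v in ball y e%:num].

Definition uniformly_open_mul (A : banachAlgType K) : Prop :=
  exists delta, witness_uniformly_open delta A.

Definition witness_equi_uniformly_open (delta : {posnum K} -> {posnum K})
    (Gamma : Type) (A : Gamma -> banachAlgType K) : Prop :=
  forall g, witness_uniformly_open delta (A g).

Definition equi_uniformly_open_mul (Gamma : Type)
    (A : Gamma -> banachAlgType K) : Prop :=
  exists delta, witness_equi_uniformly_open delta A.

End UniformOpenness.

Lemma scalars_supremums (R : realType) (k : scalar_kind)
    (S : set (scalars R k)) :
  S !=set0 -> (forall x, S x -> 0 <= x) -> has_ubound S ->
  supremums S !=set0.
Proof.
case: k S => S [s Ss] S0 [M SM].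
  exists (sup S); split; last by move=> y; apply: ge_sup; exists s.
  by move=> x Sx; apply: ub_le_sup => //; exists M.
have SE x : S x -> x = (complex.Re x)%:C%C.
  by move=> /S0; case: x => a b /=; rewrite lecE /= => /andP[/eqP ->].
have supS : has_sup [set complex.Re x | x in S].
  split; first by exists (complex.Re s), s.
  by exists (complex.Re M) => _ [x Sx <-]; have := SM _ Sx; rewrite lecE => /andP[].
exists (sup [set complex.Re x | x in S])%:C%C; split => [x Sx|y yS].
  rewrite (SE _ Sx) lecR; apply: ub_le_sup; last by exists x.
  by case: supS.
have := yS _ Ss; rewrite (SE _ Ss) !lecE /= => /andP[-> _] /=.
apply: ge_sup; first by case: supS.
by move=> _ [x Sx <-]; have := yS _ Sx; rewrite lecE => /andP[].
Qed.

Record linfty_sum (R : realType) (k : scalar_kind) (Gamma : Type)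
    (A : Gamma -> banachAlgType (scalars R k)) := LinftySum {
  coord :> forall g, A g;
  coord_bounded : has_ubound [set `|coord g| | g in [set: Gamma]]
}.

Section LinftySum.
Context {R : realType} {k : scalar_kind} {Gamma : Type}
  {A : Gamma -> banachAlgType (scalars R k)}.
Local Notation K := (scalars R k).
Local Notation L := (linfty_sum A).
Implicit Types (x y z : L) (a M : K).

Definition linfty_norm x : K := supremum 0 [set `|x g| | g in [set: Gamma]].

Lemma linfty_eq x y : (forall g, x g = y g) -> x = y.
Proof.
case: x y => [x xb] [y yb] /= xy; have {}xy : x = y by exact: functional_extensionality_dep.
by rewrite -{}xy in yb *; congr LinftySum; exact: Prop_irrelevance.
Qed.

Lemma bounded_by (x : forall g, A g) M :
  (forall g, `|x g| <= M) -> has_ubound [set `|x g| | g in [set: Gamma]].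
Proof. by move=> xM; exists M => _ [g _ <-]. Qed.

(* [supremum] is an arbitrary choice among the (at most one) least upper bounds
   of a nonempty set, and [0] on the empty set, i.e., when Gamma is empty. *)
Lemma linfty_norm_supremums x (g : Gamma) :
  supremums [set `|x g| | g in [set: Gamma]] (linfty_norm x).
Proof.
rewrite /linfty_norm /supremum; case: ifPn => [/eqP s0|_].
  by have : set0 `|x g| by rewrite -s0; exists g.
have [|||s xs] := @scalars_supremums R k [set `|x g| | g in [set: Gamma]].
- by exists `|x g|, g.
- by move=> _ [h _ <-].
- exact: coord_bounded.
by case: xgetP => [t e tP //|/(_ s)].
Qed.

Lemma le_linfty_norm x g : `|x g| <= linfty_norm x.
Proof. by have [xub _] := linfty_norm_supremums x g; apply: xub; exists g. Qed.

Lemma linfty_norm_empty x : ~ inhabited Gamma -> linfty_norm x = 0.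
Proof.
move=> G0; rewrite /linfty_norm (_ : [set _ | _ in _] = set0) ?supremum0//.
by apply/seteqP; split => // t [g]; case: G0; exists.
Qed.

Lemma linfty_norm_le x M :
  0 <= M -> (forall g, `|x g| <= M) -> linfty_norm x <= M.
Proof.
move=> M0 xM; have [[g]|/linfty_norm_empty -> //] := pselect (inhabited Gamma).
by have [_ xlub] := linfty_norm_supremums x g; apply: xlub => _ [h _ <-].
Qed.

Lemma linfty_norm_ge0 x : 0 <= linfty_norm x.
Proof.
have [[g]|/linfty_norm_empty -> //] := pselect (inhabited Gamma).
exact: le_trans (normr_ge0 (x g)) (le_linfty_norm x g).
Qed.

Lemma linfty_zero_bounded :
  has_ubound [set `|(0 : A g)| | g in [set: Gamma]].
Proof. by apply: (@bounded_by (fun=> 0) 0) => g; rewrite normr0. Qed.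

Lemma linfty_opp_bounded x : has_ubound [set `|- x g| | g in [set: Gamma]].
Proof.
apply: (@bounded_by (fun g => - x g) (linfty_norm x)) => g.
by rewrite normrN le_linfty_norm.
Qed.

Lemma linfty_add_bounded x y :
  has_ubound [set `|x g + y g| | g in [set: Gamma]].
Proof.
apply: (@bounded_by (fun g => x g + y g) (linfty_norm x + linfty_norm y)) => g.
by rewrite (le_trans (ler_normD _ _))// lerD// le_linfty_norm.
Qed.

Lemma linfty_scale_bounded a x :
  has_ubound [set `|a *: x g| | g in [set: Gamma]].
Proof.
apply: (@bounded_by (fun g => a *: x g) (`|a| * linfty_norm x)) => g.
by rewrite normrZ ler_wpM2l// le_linfty_norm.
Qed.

Lemma linfty_mul_bounded x y :
  has_ubound [set `|bmul (x g) (y g)| | g in [set: Gamma]].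
Proof.
apply: (@bounded_by (fun g => bmul (x g) (y g))
  (linfty_norm x * linfty_norm y)) => g.
by rewrite (le_trans (ler_norm_bmul _ _))// ler_pM// le_linfty_norm.
Qed.

Definition linfty_zero : L := LinftySum linfty_zero_bounded.
Definition linfty_opp x : L := LinftySum (linfty_opp_bounded x).
Definition linfty_add x y : L := LinftySum (linfty_add_bounded x y).
Definition linfty_scale a x : L := LinftySum (linfty_scale_bounded a x).
Definition linfty_mul x y : L := LinftySum (linfty_mul_bounded x y).

HB.instance Definition _ := gen_eqMixin L.
HB.instance Definition _ := gen_choiceMixin L.

Let linfty_addA : associative linfty_add.
Proof. by move=> x y z; apply: linfty_eq => g /=; rewrite addrA. Qed.
Let linfty_addC : commutative linfty_add.
Proof. by move=> x y; apply: linfty_eq => g /=; rewrite addrC. Qed.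
Let linfty_add0 : left_id linfty_zero linfty_add.
Proof. by move=> x; apply: linfty_eq => g /=; rewrite add0r. Qed.
Let linfty_addN : left_inverse linfty_zero linfty_opp linfty_add.
Proof. by move=> x; apply: linfty_eq => g /=; rewrite addNr. Qed.

HB.instance Definition _ := GRing.isZmodule.Build L
  linfty_addA linfty_addC linfty_add0 linfty_addN.

Let linfty_scaleA a b x :
  linfty_scale a (linfty_scale b x) = linfty_scale (a * b) x.
Proof. by apply: linfty_eq => g /=; rewrite scalerA. Qed.
Let linfty_scale1 : left_id 1 linfty_scale.
Proof. by move=> x; apply: linfty_eq => g /=; rewrite scale1r. Qed.
Let linfty_scaleDr : right_distributive linfty_scale +%R.
Proof. by move=> a x y; apply: linfty_eq => g /=; rewrite scalerDr. Qed.
Let linfty_scaleDl x : {morph linfty_scale^~ x : a b / a + b}.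
Proof. by move=> a b; apply: linfty_eq => g /=; rewrite scalerDl. Qed.

HB.instance Definition _ := GRing.Zmodule_isLmodule.Build K L
  linfty_scaleA linfty_scale1 linfty_scaleDr linfty_scaleDl.

Let linfty_normD x y : linfty_norm (x + y) <= linfty_norm x + linfty_norm y.
Proof.
apply: linfty_norm_le => [|g]; first by rewrite addr_ge0 ?linfty_norm_ge0.
by rewrite (le_trans (ler_normD _ _))// lerD// le_linfty_norm.
Qed.

Let linfty_normZ_le a x : linfty_norm (a *: x) <= `|a| * linfty_norm x.
Proof.
apply: linfty_norm_le => [|g]; first by rewrite mulr_ge0 ?linfty_norm_ge0.
by rewrite normrZ ler_wpM2l// le_linfty_norm.
Qed.

Let linfty_normZ a x : linfty_norm (a *: x) = `|a| * linfty_norm x.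
Proof.
apply: le_anti; rewrite linfty_normZ_le/=.
have [->|a0] := eqVneq a 0; first by rewrite normr0 mul0r linfty_norm_ge0.
rewrite -ler_pdivlMl ?normr_gt0// -normfV.
by rewrite (le_trans _ (linfty_normZ_le _ _))// scalerA mulVf// scale1r.
Qed.

Let linfty_norm_eq0 x : linfty_norm x = 0 -> x = 0.
Proof.
move=> x0; apply: linfty_eq => g; apply/eqP.
by rewrite -normr_le0 -x0 le_linfty_norm.
Qed.

HB.instance Definition _ := Lmodule_isNormed.Build K L
  linfty_normD linfty_normZ linfty_norm_eq0.

Let linfty_complete (F : set_system L) : ProperFilter F -> cauchy F -> cvg F.
Proof.
move=> FF Fc.
have coord_lip (x y : L) g : `|x g - y g| <= `|x - y|.
  exact: (le_linfty_norm (x - y) g).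
have Fball e : 0 < e -> exists x : L, F (ball x e).
  by move=> e0; have /cauchyP/(_ e e0) := Fc.
have cvgF g : cvg ((fun x : L => x g) @ F).
  apply: cauchy_cvg; apply/cauchyP => e e0.
  have [x Fx] := Fball e e0; exists (x g); rewrite /fmap /=.
  apply: filterS Fx => y; rewrite -!ball_normE /=.
  exact/le_lt_trans/coord_lip.
pose l g : A g := lim ((fun x : L => x g) @ F).
have lP (x : L) e : 0 < e -> F (ball x e) -> forall g, `|x g - l g| <= e.
  move=> e0 Fx g; apply/ler_addgt0Pr => d d0.
  have /cvgrPdist_lt/(_ d d0) Fl : (fun x : L => x g) @ F --> l g by exact: cvgF.
  have [y [/=]] := filter_ex (filterI Fx Fl); rewrite -ball_normE /= => xy ly.
  rewrite (le_trans (ler_distD (y g) _ _))// lerD//.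
    exact: le_trans (coord_lip _ _ _) (ltW xy).
  by rewrite distrC ltW.
have lb : has_ubound [set `|l g| | g in [set: Gamma]].
  have [x Fx] := Fball 1 ltr01.
  apply: (@bounded_by l (linfty_norm x + 1)) => g.
  rewrite -[l g](subrKC (x g)) (le_trans (ler_normD _ _))// lerD ?le_linfty_norm//.
  by rewrite distrC lP.
apply/cvg_ex; exists (LinftySum lb); apply/cvgrPdist_le => e e0.
have e20 : 0 < e / 2 by rewrite divr_gt0.
have [x Fx] := Fball _ e20.
near=> y; apply: linfty_norm_le; first exact: ltW.
move=> g; rewrite [e]splitr.
rewrite (le_trans (ler_distD (x g) _ _))// lerD//.
  by rewrite distrC lP.
rewrite (le_trans (coord_lip _ _ _))// ltW//.
have : ball x (e / 2) y by near: y.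
by rewrite -ball_normE.
Unshelve. all: by end_near. Qed.

HB.instance Definition _ := Uniform_isComplete.Build L linfty_complete.

Let linfty_mulA : associative linfty_mul.
Proof. by move=> x y z; apply: linfty_eq => g; exact: bmulA. Qed.
Let linfty_mulDl : left_distributive linfty_mul +%R.
Proof. by move=> x y z; apply: linfty_eq => g; exact: bmulDl. Qed.
Let linfty_mulDr : right_distributive linfty_mul +%R.
Proof. by move=> x y z; apply: linfty_eq => g; exact: bmulDr. Qed.
Let linfty_mulZl a x y : linfty_mul (a *: x) y = a *: linfty_mul x y.
Proof. by apply: linfty_eq => g; exact: bmulZl. Qed.
Let linfty_mulZr a x y : linfty_mul x (a *: y) = a *: linfty_mul x y.
Proof. by apply: linfty_eq => g; exact: bmulZr. Qed.
Let linfty_norm_mul x y : `|linfty_mul x y| <= `|x| * `|y|.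
Proof.
apply: linfty_norm_le => [|g]; first by rewrite mulr_ge0.
by rewrite (le_trans (ler_norm_bmul _ _))// ler_pM// le_linfty_norm.
Qed.

HB.instance Definition _ := CompleteNormedModule_isBanachAlgebra.Build K L
  linfty_mulA linfty_mulDl linfty_mulDr linfty_mulZl linfty_mulZr
  linfty_norm_mul.

Lemma linfty_normE x : `|x| = supremum 0 [set `|x g| | g in [set: Gamma]].
Proof. by []. Qed.

Lemma linfty_bmulE x y g : bmul x y g = bmul (x g) (y g).
Proof. by []. Qed.

End LinftySum.

(* Main.v *)
(* Applied coordinatewise, a common [delta] only gives [`|x g - u g| < e], and
    the supremum over [g] may reach [e]. The slack is recovered by homogeneity:
    if [B(xy, d)] lies in [B(x, e) B(y, e)] for all [x], [y], then
    [B(xy, t^2 d)] lies in [B(x, t e) B(y, t e)] for all [t > 0], and a point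
    at distance [< d] from [xy] is at distance [< t^2 d] for some [t < 1].
    Conversely, each [A g] sits in the sum as the tuples supported at [g]. *)

Require Import Defs.
From HB Require Import structures.
From mathcomp Require Import all_boot all_order all_algebra complex.
From mathcomp Require Import all_classical all_reals all_analysis.
From mathcomp Require Import ring.

Set Implicit Arguments.
Unset Strict Implicit.
Unset Printing Implicit Defensive.

Import Order.TTheory GRing.Theory Num.Theory.
Import numFieldNormedType.Exports.

Local Open Scope ring_scope.

(** Take [t] to be the arithmetic mean of [1] and [c / d]: its square exceeds their product [c / d]
    by [((1 - c / d) / 2) ^+ 2], and no square root is taken in [K]. *)
Lemma exists_sqr_between (K : numFieldType) (c d : K) : 0 <= c -> c < d ->
  exists t : K, [/\ 0 < t, t < 1 & c < t ^+ 2 * d].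
Proof.
move=> c0 cd; have d0 : 0 < d by exact: le_lt_trans cd.
have s0 : 0 <= c / d by rewrite divr_ge0// ltW.
have s1 : c / d < 1 by rewrite ltr_pdivrMr// mul1r.
exists ((1 + c / d) / 2); split.
- by rewrite divr_gt0// ltr_wpDr.
- by rewrite ltr_pdivrMr// mul1r ltrD2l.
rewrite -ltr_pdivrMr// -subr_gt0.
have -> : ((1 + c / d) / 2) ^+ 2 - c / d = ((1 - c / d) / 2) ^+ 2.
  by field; rewrite gt_eqF.
by rewrite exprn_gt0// divr_gt0// subr_gt0.
Qed.

Lemma bmulZZ (K : numFieldType) (A : banachAlgType K) (a : K) (x y : A) :
  bmul (a *: x) (a *: y) = a ^+ 2 *: bmul x y.
Proof. by rewrite bmulZl bmulZr scalerA -expr2. Qed.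

(** Divide [x] and [y] by [t] and [z] by [t ^+ 2], apply the witness there, and multiply both
    resulting factors by [t]. *)
Lemma witness_uniformly_open_scale (K : numFieldType)
    (delta : {posnum K} -> {posnum K}) (A : banachAlgType K) (t : K)
    (e : {posnum K}) (x y z : A) :
  witness_uniformly_open delta A -> 0 < t ->
  `|bmul x y - z| < t ^+ 2 * (delta e)%:num ->
  exists u v : A, [/\ bmul u v = z, `|x - u| < t * e%:num
                     & `|y - v| < t * e%:num].
Proof.
move=> Adelta t0 xyz; have tN0 : t != 0 by rewrite gt_eqF.
have scaleK (w : A) : t *: (t^-1 *: w) = w by rewrite scalerA mulfV// scale1r.
have normE (w w' : A) : `|w - t *: w'| = t * `|t^-1 *: w - w'|.
  by rewrite -{1}(scaleK w) -scalerBr normrZ gtr0_norm.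
have [|u ux [v vy uv]] := Adelta (t^-1 *: x) (t^-1 *: y) e (t^-1 ^+ 2 *: z).
  rewrite -ball_normE /= bmulZZ -scalerBr normrZ ger0_norm; last first.
    by rewrite exprn_ge0// invr_ge0 ltW.
  by rewrite exprVn ltr_pdivrMl// exprn_gt0.
move: ux vy; rewrite -!ball_normE /= => ux vy.
exists (t *: u), (t *: v); split; rewrite ?normE ?ltr_pM2l//.
by rewrite bmulZZ uv scalerA -exprMn mulfV// expr1n scale1r.
Qed.

Section Linfty.
Context (R : realType) (k : scalar_kind) (Gamma : Type)
  (A : Gamma -> banachAlgType (scalars R k)).
Local Notation K := (scalars R k).

Lemma witness_linfty_sum (delta : {posnum K} -> {posnum K}) :
  witness_equi_uniformly_open delta A ->
  witness_uniformly_open delta (linfty_sum A).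
Proof.
move=> Adelta x y e z; rewrite -!ball_normE /= => xyz.
(* The supremum norm is used here, so one [t] serves all coordinates. *)
have [t [t0 t1 lt_t]] := exists_sqr_between (normr_ge0 (bmul x y - z)) xyz.
have uvP g : {uv : A g * A g | [/\ bmul uv.1 uv.2 = z g,
    `|x g - uv.1| < t * e%:num & `|y g - uv.2| < t * e%:num]}.
  apply: cid; have [|u [v uv]] :=
    @witness_uniformly_open_scale _ _ _ t e (x g) (y g) (z g) (Adelta g) t0.
    exact/(le_lt_trans _ lt_t)/(le_linfty_norm (bmul x y - z) g).
  by exists (u, v).
(* The sign matters when [Gamma] is empty, where the norm is [0]. *)
have te0 : 0 <= t * e%:num by rewrite mulr_ge0// ltW.
(* Coordinates chosen uniformly close to [w] stay bounded, hence form an element of the sum; its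
   distance to [w] is at most [t * e], strictly below [e]. *)
have near_bounded (w : linfty_sum A) (f : forall g, A g) :
    (forall g, `|w g - f g| < t * e%:num) ->
    exists2 w' : linfty_sum A, (forall g, w' g = f g) & `|w - w'| < e%:num.
  move=> wf; have fb : has_ubound [set `|f g| | g in [set: Gamma]]%classic.
    apply: (@bounded_by _ _ _ _ f (t * e%:num + `|w|)) => g.
    rewrite -[f g](subrK (w g)) (le_trans (ler_normD _ _))// lerD//.
      by rewrite distrC ltW.
    exact: le_linfty_norm.
  exists (LinftySum fb) => //; apply: (@le_lt_trans _ _ (t * e%:num)).
    by apply: linfty_norm_le => // g; exact: ltW.
  by rewrite gtr_pMl.
have [|u uE xu] := near_bounded x (fun g => (sval (uvP g)).1).
  by move=> g; case: (svalP (uvP g)).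
have [|v vE yv] := near_bounded y (fun g => (sval (uvP g)).2).
  by move=> g; case: (svalP (uvP g)).
exists u => //; exists v => //; apply: linfty_eq => g.
by rewrite linfty_bmulE uE vE; case: (svalP (uvP g)).
Qed.

(** [{classic Gamma}] gives the arbitrary index type the decidable equality that [dfwith]
    requires. *)
Definition supported_at (g : Gamma) (a : A g) : forall h, A h :=
  @dfwith {classic Gamma} (fun h => A h) (fun=> 0) g a.

Lemma supported_at_in g (a : A g) : supported_at a g = a.
Proof. exact: (@dfwith_in {classic Gamma}). Qed.

Lemma supported_at_out g (a : A g) h : g <> h -> supported_at a h = 0.
Proof. by move=> gh; apply: (@dfwith_out {classic Gamma}); exact/eqP. Qed.

Lemma supported_at_bounded g (a : A g) :
  has_ubound [set `|supported_at a h| | h in [set: Gamma]]%classic.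
Proof.
apply: (@bounded_by _ _ _ _ _ `|a|) => h.
have [gh|gh] := pselect (g = h); last by rewrite supported_at_out// normr0.
by case: h / gh; rewrite supported_at_in.
Qed.

(** Embedding by [supported_at] respects products and distances, while evaluation at [g] is
    multiplicative and does not increase the norm; so factors found in the sum, whatever their other
    coordinates, project to factors in [A g]. *)
Lemma witness_linfty_summand (delta : {posnum K} -> {posnum K}) :
  witness_uniformly_open delta (linfty_sum A) ->
  witness_equi_uniformly_open delta A.
Proof.
move=> Ldelta g x y e z; rewrite -!ball_normE /= => xyz.
pose emb (a : A g) : linfty_sum A := LinftySum (supported_at_bounded a).
have embE a : emb a g = a by exact: supported_at_in.
have [|u xu [v yv uvz]] := Ldelta (emb x) (emb y) e (emb z).
  rewrite -ball_normE /=; apply: le_lt_trans xyz; apply: linfty_norm_le => // h.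
  have -> : (bmul (emb x) (emb y) - emb z) h =
    bmul (emb x h) (emb y h) - emb z h by [].
  have [gh|gh] := pselect (g = h); first by case: h / gh; rewrite !embE.
  (* Off [g], the product [bmul 0 0] vanishes by homogeneity, with the left [0] written as
     [0 *: 0]. *)
  rewrite /= !supported_at_out// -[X in bmul X _](scale0r (0 : A h)) bmulZl.
  by rewrite scale0r subrr normr0.
move: xu yv; rewrite -!ball_normE /= => xu yv.
exists (u g); first by rewrite -[x]embE (le_lt_trans (le_linfty_norm (emb x - u) g)).
exists (v g); first by rewrite -[y]embE (le_lt_trans (le_linfty_norm (emb y - v) g)).
by rewrite -linfty_bmulE uvz embE.
Qed.

End Linfty.

Theorem lemma3p2 (R : realType) (k : scalar_kind) (Gamma : Type)
    (A : Gamma -> banachAlgType (scalars R k)) :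
  (equi_uniformly_open_mul A <-> uniformly_open_mul (linfty_sum A)) /\
  (forall delta : {posnum scalars R k} -> {posnum scalars R k},
      witness_equi_uniformly_open delta A ->
      witness_uniformly_open delta (linfty_sum A)).
Proof.
split; last exact: witness_linfty_sum.
split=> -[delta Hdelta]; exists delta; first exact: witness_linfty_sum.
exact: witness_linfty_summand.
Qed.
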